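(* Let $k_1,k_2$ be positive integers and $\varepsilon>0$. There exists a constant $c(k_1,k_2,\varepsilon)>0$ such that for all positive integers $N_1,N_2$ and all $\xi\in\mathbb{R}$ with $|\xi|>N_1N_2$, $$\left|\sum_{\substack{n_1\sim N_1\\ n_2\sim N_2}}e^{i\frac{1}{n_1}\frac{1}{n_2}\xi}\right|<c(k_1,k_2,\varepsilon)\,\gamma\,(N_1N_2)^{1+\varepsilon},$$ where $$\gamma=\left\{\left(\frac{|\xi|}{N_1N_2}N_1^{-2k_1}+\frac{N_1N_2}{|\xi|}N_1^{2(k_1-1)}\right)\left(\frac{|\xi|}{N_1N_2}N_2^{-2k_2}+\frac{N_1N_2}{|\xi|}N_2^{2(k_2-1)}\right)\right\}^{1/(4k_1k_2)}.$$
   Context: $n\sim N$ means that $n$ runs over the integers of the dyadic range $N<n\le 2N$. *)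

(* Defs.v *)
From HB Require Import structures.
From mathcomp Require Export all_boot all_order all_algebra.
From mathcomp Require Export complex.
From mathcomp Require Export reals exp trigo.

Set Implicit Arguments.
Unset Strict Implicit.
Unset Printing Implicit Defensive.

Import Order.TTheory GRing.Theory Num.Theory.

Local Open Scope ring_scope.
Local Open Scope complex_scope.

(* e^{i t} for real t, through Euler's formula: MathComp-Analysis has no complex
   exponential. *)
Definition expi (R : realType) (t : R) : R[i] := cos t +i* sin t.

(* |xi| / (N1 N2) * N^(-2k) + N1 N2 / |xi| * N^(2(k-1)); used for k >= 1 only, so
   that [k.-1] is k - 1. *)
Definition gamma_factor (R : realType) (N1 N2 : nat) (xi : R) (N k : nat) : R :=
  `|xi| / (N1%:R * N2%:R) * N%:R ^- (2 * k)
  + N1%:R * N2%:R / `|xi| * N%:R ^+ (2 * k.-1).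

Definition gamma (R : realType) (k1 k2 N1 N2 : nat) (xi : R) : R :=
  (gamma_factor N1 N2 xi N1 k1 * gamma_factor N1 N2 xi N2 k2)
    `^ ((4 * k1 * k2)%N%:R^-1).

(* Main.v *)
(* Write s(x) for the sum of the reciprocals of a k-tuple x from (N, 2N], and
   T = |xi| / (N1 N2).  Two applications of Holder's inequality bound the
   (k1 k2)-th power of the sum by a bilinear form in e(xi s(x) s(y)) with
   coefficients of modulus at most 1.  Writing s(x) = c d1 + u, s(y) = d d2 + v with
   xi d1 d2 = 2 pi / M and M comparable to T, the phase becomes 2 pi c d / M up to the
   factors e(xi u s(y)) and e(xi c d1 v), whose exponents are bounded by 2 pi and which
   therefore cost only a constant; Cauchy-Schwarz and the discrete Parseval identity
   then reduce everything to the number of pairs (x, x') with s(x), s(x') in the same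
   cell.  As distinct values of s are (2N)^(-2k)-separated, that number is controlled by
   the number of solutions of s(x) = s(x').  For such a solution every prime dividing
   the product of all the denominators divides it twice, so the product is squarefull,
   and the divisor bound gives O(N^(k + eps)) solutions. *)
Require Import Defs.
From mathcomp Require Import zify ring lra.
From mathcomp Require Import topology normedtype derive.
Import Order.TTheory GRing.Theory Num.Theory.
Import numFieldNormedType.Exports.

Set Implicit Arguments.
Unset Strict Implicit.
Unset Printing Implicit Defensive.

(** * Coincidences among sums of reciprocals *)

Local Open Scope nat_scope.

(** * The divisor bound *)

Lemma leq_exp_base m n e : m <= n -> m ^ e <= n ^ e.
Proof. by case: e => // e mn; rewrite leq_exp2r. Qed.

(** A divisor of p^e m has the form p^i d with i <= e and d | m, so these products exhaust the
    divisors. *)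
Lemma size_divisors_pfactorM p e m : prime p -> coprime p m -> 0 < m ->
  size (divisors (p ^ e * m)) <= e.+1 * size (divisors m).
Proof.
move=> pp cpm m0.
have n0 : 0 < p ^ e * m by rewrite muln_gt0 expn_gt0 prime_gt0.
rewrite -{1}(size_iota 0 e.+1) -(size_allpairs (fun i d => p ^ i * d)).
apply: uniq_leq_size; first exact: divisors_uniq.
move=> d; rewrite -dvdn_divisors// => dn.
have d0 : 0 < d by apply: dvdn_gt0 dn.
have [d' cpd' dE] := pfactor_coprime pp d0.
apply/allpairsP; exists (logn p d, d') => /=; split.
- rewrite (mem_iota 0 e.+1) /= add0n ltnS.
  have := dvdn_leq_log p n0 dn.
  by rewrite lognM ?expn_gt0 ?(prime_gt0 pp)// pfactorK// (logn_coprime cpm) addn0.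
- have cd' : coprime d' (p ^ e) by rewrite coprime_sym coprimeXl.
  rewrite -(dvdn_divisors d' m0) -(Gauss_dvdr _ cd').
  by apply: dvdn_trans dn; rewrite [X in _ %| X]dE dvdn_mulr.
- by rewrite mulnC.
Qed.

(** With q the integer part of e / K, e + 1 <= K (q + 1) <= K 2^q; now take K-th powers and use q K
    <= e. *)
Lemma expnS_le_exp2 K e : 0 < K -> e.+1 ^ K <= K ^ K * 2 ^ e.
Proof.
move=> K0.
have h : e.+1 <= K * 2 ^ (e %/ K).
  apply: leq_trans (ltn_ceil e K0) _.
  by rewrite mulnC leq_mul2l ltn_expl// orbT.
apply: (@leq_trans ((K * 2 ^ (e %/ K)) ^ K)); first by rewrite leq_exp2r.
by rewrite expnMn leq_mul2l -expnM leq_exp2l// leq_divM orbT.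
Qed.

(** A prime power p^e contributes (e + 1)^K on the left and p^e on the right. For p >= 2^K the
    former is at most 2^(e K) <= p^e; each of the fewer than 2^K smaller primes costs a factor
    K^K. *)
Lemma divisor_bound K : 0 < K ->
  exists2 D, 0 < D & forall n, 0 < n -> size (divisors n) ^ K <= D * n.
Proof.
move=> K0; exists ((K ^ K) ^ (2 ^ K)); first by rewrite !expn_gt0 K0.
have KK0 : 0 < K ^ K by rewrite expn_gt0 K0.
(* Induction on a strict upper bound q for the prime factors; min(q, 2^K) bounds the number of
   primes that have cost a factor K^K. *)
suff H q : forall n, 0 < n -> (forall p, prime p -> p %| n -> p < q) ->
    size (divisors n) ^ K <= (K ^ K) ^ minn q (2 ^ K) * n.
  move=> [//|n] _.
  apply: leq_trans (H n.+2 n.+1 isT _) _.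
    by move=> p _ pn; rewrite ltnS dvdn_leq.
  by rewrite leq_mul// leq_pexp2l// geq_minr.
elim: q => [|q IH] n n0 hp.
  have [n1|n1] := leqP n 1; last first.
    by have := hp _ (pdiv_prime n1) (pdiv_dvd n).
  have -> : n = 1 by lia.
  by rewrite min0n expn0 (_ : size _ = 1)// exp1n.
have [/andP[pq qn]|nq] := boolP (prime q && (q %| n)); last first.
  apply: leq_trans (IH n n0 _) _.
    move=> p pp pn; have := hp p pp pn; rewrite ltnS leq_eqVlt => /orP[/eqP pq|//].
    by move: nq; rewrite -pq pp pn.
  by rewrite leq_mul// leq_pexp2l//; lia.
have [m cqm nE] := pfactor_coprime pq n0; set e := logn q n in nE.
have m0 : 0 < m by case: (m) nE n0 => // ->.
have {}IH : size (divisors m) ^ K <= (K ^ K) ^ minn q (2 ^ K) * m.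
  apply: IH => // p pp pm.
  have := hp p pp; rewrite nE dvdn_mulr// => /(_ isT); rewrite ltnS leq_eqVlt.
  case/orP => // /eqP pq'; move: cqm; rewrite -pq' prime_coprime//.
  by rewrite pm.
have : size (divisors n) ^ K <= e.+1 ^ K * size (divisors m) ^ K.
  by rewrite -expnMn leq_exp2r// nE mulnC size_divisors_pfactorM.
move/leq_trans; apply.
rewrite nE; have [qK|qK] := ltnP q (2 ^ K).
  have -> : minn q.+1 (2 ^ K) = (minn q (2 ^ K)).+1 by lia.
  rewrite expnS; move: IH; set c := _ ^ minn _ _ => IH.
  have : e.+1 ^ K <= K ^ K * q ^ e.
    apply: leq_trans (expnS_le_exp2 e K0) _.
    by rewrite leq_mul// leq_exp_base// prime_gt1.
  by move=> /leq_mul/(_ IH)/leq_trans; apply; rewrite !mulnA -!(mulnAC _ m) mulnAC.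
have -> : minn q.+1 (2 ^ K) = minn q (2 ^ K) by lia.
have : e.+1 ^ K <= q ^ e.
  apply: (@leq_trans ((2 ^ e) ^ K)); first by rewrite leq_exp2r// ltn_expl.
  by rewrite -expnM mulnC expnM leq_exp_base.
by move=> /leq_mul/(_ IH)/leq_trans; apply; rewrite mulnC mulnA.
Qed.

(** * Squarefull numbers *)

Definition squarefull n := forall p, prime p -> p %| n -> p ^ 2 %| n.

(** Strip off one full prime power p^e, where e >= 2. An even e goes entirely into a; an odd e is at
    least 3, so one p goes into b and the remaining even exponent e - 3 into a. *)
Lemma squarefull_sq_cube n : 0 < n -> squarefull n ->
  exists a b, n = a ^ 2 * b ^ 3.
Proof.
have [r] := ubnP n; elim: r n => // r IH n; rewrite ltnS => nr n0 sn.
have [n1|n1] := leqP n 1; first by exists 1, 1; lia.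
have pp := pdiv_prime n1; set p := pdiv n in pp.
have pn : p %| n := pdiv_dvd n.
have [m cpm nE] := pfactor_coprime pp n0; set e := logn p n in nE.
have m0 : 0 < m by case: (m) nE n0 => // ->.
have e2 : 1 < e by rewrite -pfactor_dvdn// sn.
have mn : m < n.
  by rewrite nE -[X in X < _]muln1 ltn_pmul2l// -[1](exp1n e) ltn_exp2r ?prime_gt1//; lia.
have [q qq qm|a [b mE]] := IH m (leq_trans mn nr) m0.
  have qp : coprime q p.
    rewrite prime_coprime// dvdn_prime2//; apply/eqP => qp.
    by move: cpm; rewrite -qp prime_coprime// qm.
  have := sn q qq; rewrite nE dvdn_mulr// => /(_ isT).
  by rewrite Gauss_dvdl// coprimeXl// coprimeXr.
have [oe|oe] := boolP (odd e).
  exists (a * p ^ (e - 3)./2), (b * p).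
  have {1}-> : n = m * p ^ (((e - 3)./2) * 2 + 3) by rewrite nE; congr (_ * _ ^ _); lia.
  by rewrite mE expnD !expnMn expnM; lia.
exists (a * p ^ e./2), b.
have {1}-> : n = m * p ^ (e./2 * 2) by rewrite nE; congr (_ * _ ^ _); lia.
by rewrite mE !expnMn expnM; lia.
Qed.

(** * Tuples of denominators and their products *)

Section DyadicTuples.
Variables k N : nat.
Implicit Types x : {ffun 'I_k -> 'I_N}.

(* [x] encodes the [k]-tuple of the integers [N + x l + 1], which range over (N, 2N]. *)
Definition dyadic x (l : 'I_k) := (N + x l).+1.
Definition dyadic_prod x := \prod_l dyadic x l.
Definition dyadic_num x := \sum_l \prod_(l' | l' != l) dyadic x l'.

(* sum_l 1 / dyadic x l is [dyadic_num x / dyadic_prod x]; the equality of two such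
   sums is cross-multiplied. *)
Definition equal_reciprocal_sums :=
  [set z : {ffun 'I_k -> 'I_N} * {ffun 'I_k -> 'I_N} |
    dyadic_num z.1 * dyadic_prod z.2 == dyadic_num z.2 * dyadic_prod z.1].

Lemma dyadic_le x l : dyadic x l <= 2 * N.
Proof. by rewrite /dyadic; have := ltn_ord (x l); lia. Qed.

Lemma dyadic_prod_gt0 x : 0 < dyadic_prod x.
Proof. exact: prodn_gt0. Qed.

Lemma dyadic_prod_le x : dyadic_prod x <= (2 * N) ^ k.
Proof.
rewrite -[k in X in _ <= X]card_ord -prod_nat_const.
by apply: leq_prod => l _; exact: dyadic_le.
Qed.

(** Exactly one denominator is divisible by p, so p divides every term of the numerator except the
    one that omits this denominator. *)
Lemma dyadic_simple_prime_num p x : prime p -> p %| dyadic_prod x ->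
  ~~ (p ^ 2 %| dyadic_prod x) -> ~~ (p %| dyadic_num x).
Proof.
move=> pp; rewrite /dyadic_prod Euclid_dvd_prod// big_orE => /existsP[l /= pl].
rewrite (bigD1 l)//= => p2.
have pQ : ~~ (p %| \prod_(l' | l' != l) dyadic x l').
  by apply: contra p2 => pQ; rewrite -mulnn dvdn_mul.
rewrite /dyadic_num (bigD1 l)//= dvdn_addl//.
apply: dvdn_sum => l' l'l.
by rewrite (bigD1 l) 1?eq_sym//= dvdn_mulr.
Qed.

(** If p divides the product of x only once, it does not divide the numerator of x, and the
    cross-multiplied equation forces it into the product of y. *)
Lemma dvd_num_prod p x y : prime p ->
  dyadic_num x * dyadic_prod y = dyadic_num y * dyadic_prod x ->
  p %| dyadic_prod x -> p ^ 2 %| dyadic_prod x * dyadic_prod y.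
Proof.
move=> pp exy px.
have [p2|p2] := boolP (p ^ 2 %| dyadic_prod x); first exact: dvdn_mulr.
have pA := dyadic_simple_prime_num pp px p2.
have : p %| dyadic_num x * dyadic_prod y by rewrite exy dvdn_mull.
by rewrite Euclid_dvdM// (negbTE pA)/= -mulnn => py; rewrite dvdn_mul.
Qed.

(* A prime dividing exactly one denominator, to the first power, could not cancel. *)
Lemma equal_reciprocal_sums_squarefull z : z \in equal_reciprocal_sums ->
  squarefull (dyadic_prod z.1 * dyadic_prod z.2).
Proof.
rewrite inE => /eqP ez p pp; rewrite Euclid_dvdM// => /orP[p1|p2].
  exact: dvd_num_prod.
by rewrite mulnC; apply: dvd_num_prod.
Qed.

(** Each of the 2k denominators of such a pair is a divisor of n. *)
Lemma card_dyadic_prod_fiber n : 0 < n ->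
  #|[pred z : {ffun 'I_k -> 'I_N} * {ffun 'I_k -> 'I_N} |
      dyadic_prod z.1 * dyadic_prod z.2 == n]| <= size (divisors n) ^ (2 * k).
Proof.
move=> n0; pose D := [pred i : 'I_N | (N + i).+1 %| n].
have cD : #|D| <= size (divisors n).
  rewrite cardE -(size_map (fun i : 'I_N => (N + i).+1)).
  apply: uniq_leq_size.
    rewrite map_inj_uniq ?enum_uniq// => i j [] /addnI; exact: val_inj.
  move=> m; case/mapP => i; rewrite mem_enum inE => iD ->.
  by rewrite -dvdn_divisors.
apply: (@leq_trans (#|D| ^ (2 * k))); last exact: leq_exp_base.
have -> : #|D| ^ (2 * k) = #|[predX (ffun_on D : {pred {ffun 'I_k -> 'I_N}}) &
    (ffun_on D : {pred {ffun 'I_k -> 'I_N}})]|.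
  by rewrite cardX card_ffun_on card_ord -expnD addnn -mul2n.
apply: subset_leq_card; apply/subsetP => -[x y]; rewrite !inE /= => /eqP xyn.
have dv (t : {ffun 'I_k -> 'I_N}) l : dyadic t l %| dyadic_prod t.
  by rewrite /dyadic_prod (bigD1 l)//= dvdn_mulr.
apply/andP; split; apply/ffun_onP => l; rewrite inE -xyn.
  by apply: dvdn_mulr; exact: dv.
by apply: dvdn_mull; exact: dv.
Qed.

End DyadicTuples.

(* Writing n = a^2 b^3 gives a b <= Z. *)
Lemma card_squarefull Z B (S : {set 'I_(Z ^ 2).+1}) :
  (forall m, 0 < m <= Z -> size (divisors m) <= B) ->
  (forall n, n \in S -> 0 < n /\ squarefull n) -> #|S| <= Z * B.
Proof.
move=> hB hS.
(* The pair (a, b) is recorded as m = a b with a divisor a of m; (a b)^2 <= a^2 b^3 <= Z^2 gives m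
   <= Z. *)
pose L := [seq a ^ 2 * (m %/ a) ^ 3 | m <- iota 1 Z, a <- divisors m].
apply: (@leq_trans (size L)).
  rewrite cardE -(size_map (@nat_of_ord _)).
  apply: uniq_leq_size; first by rewrite map_inj_uniq ?enum_uniq//; exact: val_inj.
  move=> m; case/mapP => n; rewrite mem_enum => /hS[n0 sn] ->{m}.
  have [a [b nE]] := squarefull_sq_cube n0 sn.
  have a0 : 0 < a by case: (a) nE n0 => // ->.
  have b0 : 0 < b by case: (b) nE n0 => // ->; rewrite muln0.
  apply/allpairsPdep; exists (a * b), a; split.
  - rewrite mem_iota add1n ltnS muln_gt0 a0 b0/=.
    rewrite -(@leq_exp2r _ _ 2)//.
    apply: leq_trans (_ : n <= _); last by rewrite -ltnS.
    by rewrite nE expnMn leq_mul// leq_pexp2l.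
  - by rewrite -dvdn_divisors ?muln_gt0 ?a0// dvdn_mulr.
  - by rewrite mulKn.
rewrite size_allpairs_dep sumnE big_map -[X in _ <= X * _](size_iota 1 Z).
rewrite -sum1_size big_distrl/=; rewrite big_seq [X in _ <= X]big_seq.
apply: leq_sum => m; rewrite mem_iota add1n ltnS mul1n => mZ.
exact: hB.
Qed.

(** Sort the coincidences by the product n <= Z^2 of all denominators, Z = (2N)^k. This product is
    squarefull, so it takes at most Z B values, and each value has at most B^(2k) preimages. *)
Lemma card_equal_reciprocal_sums_le k N B :
  (forall m, 0 < m <= ((2 * N) ^ k) ^ 2 -> size (divisors m) <= B) ->
  #|equal_reciprocal_sums k N| <= (2 * N) ^ k * B ^ (2 * k).+1.
Proof.
move=> hB; set Z := (2 * N) ^ k in hB *.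
pose P (z : {ffun 'I_k -> 'I_N} * {ffun 'I_k -> 'I_N}) : 'I_(Z ^ 2).+1 :=
  inord (dyadic_prod z.1 * dyadic_prod z.2).
have PE z : P z = dyadic_prod z.1 * dyadic_prod z.2 :> nat.
  by rewrite inordK// ltnS -mulnn leq_mul// dyadic_prod_le.
pose S := P @: equal_reciprocal_sums k N.
rewrite -sum1_card (partition_big_imset P)/= -/S.
apply: (@leq_trans (\sum_(n in S) B ^ (2 * k))).
  apply: leq_sum => n /imsetP[z zE ->].
  have P0 : 0 < P z by rewrite PE muln_gt0 !dyadic_prod_gt0.
  apply: leq_trans (leq_exp_base _ (hB (P z) _)); last by rewrite P0 -ltnS/=.
  apply: leq_trans (card_dyadic_prod_fiber k N P0).
  rewrite sum1_card; apply: subset_leq_card; apply/subsetP => w.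
  by rewrite !inE => /andP[_ /eqP <-]; rewrite PE.
rewrite sum_nat_const (expnS B) mulnA leq_mul//.
apply: card_squarefull => [m /andP[m0 mZ]|n /imsetP[z zE ->]].
  apply: hB; rewrite m0 (leq_trans mZ)// -mulnn leq_pmulr//.
  exact: leq_trans m0 mZ.
rewrite PE; split; first by rewrite muln_gt0 !dyadic_prod_gt0.
exact: equal_reciprocal_sums_squarefull.
Qed.

(** The K-th power keeps the estimate among integers. As B^K <= D Z^2, the 2k + 1 factors B cost
    N^(2k(2k+1)) up to a constant, hence only N^(2k(2k+1)/K) after extracting the root. *)
Lemma card_equal_reciprocal_sums k K : 0 < K ->
  exists2 C, 0 < C & forall N, #|equal_reciprocal_sums k N| ^ K <=
    C * N ^ (k * K + 2 * k * (2 * k).+1).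
Proof.
move=> K0; have [D D0 hD] := divisor_bound K0.
exists (2 ^ (k * K + 2 * k * (2 * k).+1) * D ^ (2 * k).+1).
  by rewrite muln_gt0 !expn_gt0 D0.
move=> N; set Z := (2 * N) ^ k.
pose B := \max_(m < (Z ^ 2).+1 | 0 < m) size (divisors m).
have BK : B ^ K <= D * Z ^ 2.
  rewrite /B; elim/big_ind: _ => [|a b|m m0]; first by rewrite exp0n.
    by rewrite /maxn; case: ifP.
  by apply: leq_trans (hD _ m0) _; rewrite leq_mul// -ltnS.
apply: (@leq_trans ((Z * B ^ (2 * k).+1) ^ K)).
  apply/leq_exp_base/card_equal_reciprocal_sums_le => m /andP[m0 mZ].
  pose i : 'I_(Z ^ 2).+1 := inord m.
  have iE : i = m :> nat by rewrite inordK.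
  by rewrite -iE /B (bigD1 i) ?iE//= leq_maxl.
rewrite expnMn -expnM mulnC -(mulnC K) expnM.
apply: leq_trans (leq_mul (leq_exp_base _ BK) (leqnn _)) _.
set r := (2 * k).+1.
rewrite (mulnC (2 ^ _)) -mulnA -expnMn expnMn -mulnA leq_mul// /Z -!expnM -expnD.
by apply: eq_leq; congr (_ ^ _); lia.
Qed.

(** * Bilinear forms with a multiplicative phase *)

Local Open Scope ring_scope.
Local Open Scope complex_scope.

Local Notation normc := Normc.normc.

(** * The complex modulus and the function e^(it) *)

Section ComplexModulus.
Variable R : realType.
Implicit Types (z w : R[i]) (t : R).

Lemma normc_ge0 z : 0 <= normc z.
Proof. by case: z => a b; exact: sqrtr_ge0. Qed.

Lemma ler_normc_sum (I : Type) (r : seq I) (P : pred I) (F : I -> R[i]) :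
  normc (\sum_(i <- r | P i) F i) <= \sum_(i <- r | P i) normc (F i).
Proof. exact: (@ler_norm_sum R (Rcomplex R)). Qed.

Lemma normc_real t : normc t%:C = `|t|.
Proof. by rewrite /= expr0n/= addr0 sqrtr_sqr. Qed.

Lemma normcX z n : normc (z ^+ n) = normc z ^+ n.
Proof. by elim: n => [|n IH]; rewrite ?expr0 ?Normc.normc1// !exprS Normc.normcM IH. Qed.

Lemma normc_prod (I : Type) (r : seq I) (P : pred I) (F : I -> R[i]) :
  normc (\prod_(i <- r | P i) F i) = \prod_(i <- r | P i) normc (F i).
Proof. by apply: big_morph => [z w|]; rewrite ?Normc.normcM ?Normc.normc1. Qed.

Lemma normc_sqrE z : (normc z ^+ 2)%:C = z * z^*%C.
Proof. by rewrite rmorphXn; exact: sqr_normc. Qed.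

Lemma normc_conj z : normc z^*%C = normc z.
Proof. by case: z => x y; rewrite /= sqrrN. Qed.

Lemma expi0 : expi 0 = 1 :> R[i].
Proof. by rewrite /expi cos0 sin0. Qed.

Lemma expiD t u : expi (t + u) = expi t * expi u.
Proof.
by rewrite /expi cosD sinD; simpc; congr (_ +i* _); rewrite addrC mulrC [X in _ + X]mulrC.
Qed.

Lemma expi_conj t : (expi t)^*%C = expi (- t).
Proof. by rewrite /expi cosN sinN. Qed.

Lemma normc_expi t : normc (expi t) = 1.
Proof. by rewrite /= cos2Dsin2 sqrtr1. Qed.

Lemma expi_sum (I : Type) (r : seq I) (P : pred I) (F : I -> R) :
  expi (\sum_(i <- r | P i) F i) = \prod_(i <- r | P i) expi (F i).
Proof. by apply: big_morph => [t u|]; rewrite ?expiD ?expi0. Qed.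

Lemma expiMn t n : expi (t *+ n) = expi t ^+ n.
Proof. by elim: n => [|n IH]; rewrite ?expi0// mulrS exprS expiD IH. Qed.

Lemma expi_2pi_eq1 n : expi (2 * pi *+ n) = 1 :> R[i].
Proof.
by rewrite expiMn /expi mulrC mulr_natr cos2pi sin2pi (_ : 1 +i* 0 = 1)// expr1n.
Qed.

Lemma ler_norm_sin t : `|sin t| <= `|t|.
Proof.
wlog t0 : t / 0 <= t.
  move=> H; have [/H//|t0] := leP 0 t.
  by rewrite -normrN -sinN -[leRHS]normrN H// oppr_ge0 ltW.
have [|c _] := @derive.MVT_segment R (@sin R) (@cos R) 0 t t0.

  exact: (subspace_topology.continuous_subspaceT (@continuous_sin R)).
rewrite sin0 !subr0 => ->.
by rewrite normrM ler_piMl// cos_max.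
Qed.

(** By the half-angle formulas the modulus is 2 |sin(t/2)|. *)
Lemma normc_one_sub_expi t : normc (1 - expi t) <= `|t|.
Proof.
rewrite -[leRHS]sqrtr_sqr /= ler_sqrt ?sqr_ge0// sub0r sqrrN.
have -> : t = (t / 2) *+ 2 by field.
set u := t / 2.
have : sin u ^+ 2 <= u ^+ 2.
  by rewrite -(real_normK (num_real u)) -(real_normK (num_real (sin u))) lerXn2r
    ?nnegrE// ler_norm_sin.
rewrite cos_mulr2n sin_mulr2n -[X in X - 1]mulr_natr.
have := cos2Dsin2 u; nra.
Qed.

(** Removes absolute values inside sums at the cost of a bounded coefficient; modulus at most 1
    rather than exactly 1 allows c = 0 at z = 0. *)
Lemma normc_phase z : exists2 c : R[i], normc c <= 1 & (normc z)%:C = c * z.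
Proof.
have [->|z0] := eqVneq z 0.
  by exists 0; rewrite ?Normc.normc0// mulr0.
have nz : normc z != 0 by apply: contra_neq z0 => /Normc.eq0_normc.
exists ((normc z)%:C / z); last by rewrite divfK.
by rewrite Normc.normcM Normc.normcV normc_real ger0_norm ?normc_ge0// divff.
Qed.

End ComplexModulus.

(** * The Cauchy-Schwarz and power mean inequalities *)

Section RealSums.
Variables (R : realDomainType) (I : finType).
Implicit Types (a b t : I -> R).

Lemma cauchy_schwarz_sum a b :
  (\sum_i a i * b i) ^+ 2 <= (\sum_i a i ^+ 2) * (\sum_i b i ^+ 2).
Proof.
(* Lagrange's identity: this sum of squares is twice the difference of the two sides. *)
have : 0 <= \sum_i \sum_j (a i * b j - a j * b i) ^+ 2.
  by apply: sumr_ge0 => i _; apply: sumr_ge0 => j _; exact: sqr_ge0.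
have -> : \sum_i \sum_j (a i * b j - a j * b i) ^+ 2 =
    (\sum_i \sum_j a i ^+ 2 * b j ^+ 2 + \sum_i \sum_j a j ^+ 2 * b i ^+ 2)
    - 2 * \sum_i \sum_j (a i * b i) * (a j * b j).
  rewrite mulr_sumr -big_split -sumrB; apply: eq_bigr => i _ /=.
  rewrite mulr_sumr -big_split -sumrB; apply: eq_bigr => j _ /=; ring.
rewrite [X in _ + X - _]exchange_big /= -!big_distrlr/=; lra.
Qed.

Lemma power_mean_sum n t : (forall i, 0 <= t i) ->
  (\sum_i t i) ^+ n.+1 <= #|I|%:R ^+ n * \sum_i t i ^+ n.+1.
Proof.
move=> t0; elim: n => [|n IH]; first by rewrite expr0 mul1r expr1.
rewrite exprSr; apply: le_trans (ler_wpM2r _ IH) _; first exact: sumr_ge0.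
rewrite exprSr -!mulrA ler_wpM2l ?exprn_ge0//.
(* Chebyshev's sum inequality: t^(n+1) and t are ordered alike, so every term is nonnegative. *)
have : 0 <= \sum_i \sum_j (t i ^+ n.+1 - t j ^+ n.+1) * (t i - t j).
  apply: sumr_ge0 => i _; apply: sumr_ge0 => j _.
  have [tij|tij] := leP (t i) (t j).
    by rewrite mulr_le0// subr_le0// ler_pXn2r// ?nnegrE.
  by rewrite mulr_ge0// subr_ge0 ?ler_pXn2r ?nnegrE// ltW.
have -> : \sum_i \sum_j (t i ^+ n.+1 - t j ^+ n.+1) * (t i - t j) =
    (\sum_i \sum_(j : I) t i ^+ n.+2 + \sum_(i : I) \sum_j t j ^+ n.+2)
    - (\sum_i \sum_j t i ^+ n.+1 * t j + \sum_i \sum_j t j ^+ n.+1 * t i).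
  rewrite -!big_split -sumrB; apply: eq_bigr => i _ /=.
  rewrite -!big_split -sumrB; apply: eq_bigr => j _ /=.
  rewrite !(exprSr _ n.+1); ring.
rewrite [X in _ - (_ + X)]exchange_big /= -!big_distrlr/=.
have -> : \sum_i \sum_(j : I) t i ^+ n.+2 = #|I|%:R * \sum_i t i ^+ n.+2.
  by rewrite mulr_sumr; apply: eq_bigr => i _; rewrite sumr_const mulr_natl.
have -> : \sum_(i : I) \sum_j t j ^+ n.+2 = #|I|%:R * \sum_i t i ^+ n.+2.
  by rewrite sumr_const mulr_natl.
lra.
Qed.

End RealSums.

(** * Bilinear forms with bounded coefficients *)

Section BilinearForms.
Variable R : realType.
Implicit Types I J T : finType.

(** Uniformity in the coefficients lets any factor of modulus at most 1 that depends on one variable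
    only be absorbed. *)
Definition bilinear_bound I J (k : I -> J -> R[i]) (B : R) :=
  forall (a : I -> R[i]) (b : J -> R[i]),
    (forall i, normc (a i) <= 1) -> (forall j, normc (b j) <= 1) ->
    normc (\sum_i \sum_j a i * b j * k i j) <= B.

Lemma bilinear_bound_eq I J (k k' : I -> J -> R[i]) B :
  (forall i j, k i j = k' i j) -> bilinear_bound k B -> bilinear_bound k' B.
Proof.
move=> kk' kB a b a1 b1; apply: le_trans (kB a b a1 b1).
by under [in leRHS]eq_bigr do under eq_bigr do rewrite kk'.
Qed.

Lemma bilinear_bound_sym I J (k : I -> J -> R[i]) B :
  bilinear_bound k B -> bilinear_bound (fun j i => k i j) B.
Proof.
move=> kB b a b1 a1; rewrite exchange_big /=; apply: le_trans (kB a b a1 b1).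
by under eq_bigr do under eq_bigr do rewrite (mulrC (b _)).
Qed.

Lemma bilinear_bound_scale I J (k : I -> J -> R[i]) B (c : R) a b :
  bilinear_bound k B -> 0 <= c ->
  (forall i, normc (a i) <= 1) -> (forall j, normc (b j) <= c) ->
  normc (\sum_i \sum_j a i * b j * k i j) <= c * B.
Proof.
move=> kB c0 a1 bc.
pose b' j := (c^-1)%:C * b j.
have bE j : b j = c%:C * b' j.
  have [c00|cn0] := eqVneq c 0.
    rewrite /b' c00 mul0r; apply: Normc.eq0_normc.
    by apply/eqP; rewrite eq_le normc_ge0 andbT -c00.
  by rewrite /b' mulrA -rmorphM divff// mul1r.
have -> : \sum_i \sum_j a i * b j * k i j = c%:C * \sum_i \sum_j a i * b' j * k i j.
  rewrite mulr_sumr; apply: eq_bigr => i _; rewrite mulr_sumr; apply: eq_bigr => j _.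
  by rewrite bE; ring.
rewrite Normc.normcM normc_real ger0_norm// ler_wpM2l// kB// => j.
rewrite /b' Normc.normcM normc_real ger0_norm ?invr_ge0//.
have [->|cn0] := eqVneq c 0; first by rewrite invr0 mul0r.
by rewrite ler_pdivrMl ?mulr1// lt_def cn0.
Qed.

(** Induction along the ordered values of u. Moving the base point from x to the next value t splits
    off e((t - x) y), which depends on j only and is absorbed into b. Only the indices with u = x
    need a correction, with coefficient 1 - e((t - x) y) of modulus at most (t - x) L; these costs
    telescope. *)
Lemma bilinear_bound_expi_path I J (k : I -> J -> R[i]) (B L : R)
    (u : I -> R) (y : J -> R) (x : R) (s : seq R) :
  0 <= L -> (forall j, `|y j| <= L) -> bilinear_bound k B ->
  path <=%R x s -> (forall i, u i \in x :: s) ->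
  bilinear_bound (fun i j => k i j * expi ((u i - x) * y j))
    ((1 + (last x s - x) * L) * B).
Proof.
move=> L0 yL kB.
elim: s x u => [|t s IH] x u /= => [_ us|/andP[xt ps] us] a b a1 b1.
  rewrite subrr mul0r addr0 mul1r; apply: le_trans (kB a b a1 b1).
  under eq_bigr => i _ do under eq_bigr => j _ do
    (have /[!inE] /eqP -> := us i; rewrite subrr mul0r expi0 mulr1).
  exact: lexx.
(* Values below t are raised to t; [a'] keeps the indices where this changes the phase. *)
pose u' i := Num.max (u i) t.
pose a' i := if u i < t then a i else 0.
pose e j : R[i] := expi ((t - x) * y j).
have us' i : u' i \in t :: s.
  have := us i; rewrite inE => /orP[/eqP ux|tus].
    by rewrite /u' ux (max_idPr xt) mem_head.
  rewrite /u'; have := tus; rewrite inE => /orP[/eqP ->|uis].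
    by rewrite maxxx mem_head.
  have /allP/(_ _ uis) tu := order_path_min le_trans ps.
  by rewrite (max_idPl tu).
have be j : normc (b j * e j) <= 1 by rewrite Normc.normcM normc_expi mulr1.
have a'1 i : normc (a' i) <= 1 by rewrite /a'; case: ifP; rewrite ?Normc.normc0.
have bt j : normc (b j * (1 - e j)) <= (t - x) * L.
  rewrite Normc.normcM -[leRHS]mul1r ler_pM ?normc_ge0//.
  apply: le_trans (normc_one_sub_expi _) _.
  by rewrite normrM ger0_norm ?subr_ge0// ler_wpM2l// subr_ge0.
have -> : \sum_i \sum_j a i * b j * (k i j * expi ((u i - x) * y j)) =
    \sum_i \sum_j a i * (b j * e j) * (k i j * expi ((u' i - t) * y j)) +
    \sum_i \sum_j a' i * (b j * (1 - e j)) * k i j.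
  rewrite -big_split; apply: eq_bigr => i _; rewrite -big_split /=.
  apply: eq_bigr => j _; rewrite /a' /e /u'; have [ut|tu] := ltP (u i) t.
    have -> : u i = x.
      have := us i; rewrite !inE => /or3P[/eqP//|/eqP tE|uis].
        by move: ut; rewrite tE ltxx.
      have /allP/(_ _ uis) tu := order_path_min le_trans ps.
      by move: (le_lt_trans tu ut); rewrite ltxx.
    by rewrite !subrr !mul0r expi0; ring.
  rewrite (_ : (u i - x) * y j = (t - x) * y j + (u i - t) * y j); last by ring.
  by rewrite expiD; ring.
apply: le_trans (le_normcD _ _) _.
have := IH t u' ps us' a _ a1 be.
have := bilinear_bound_scale kB _ a'1 bt; rewrite mulr_ge0 ?subr_ge0// => /(_ isT).
lra.
Qed.

(* Telescoping in the values of u, this replaces partial summation. *)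
Lemma bilinear_bound_expi I J (k : I -> J -> R[i]) (B U L : R)
    (u : I -> R) (y : J -> R) :
  0 <= U -> 0 <= L -> 0 <= B -> (forall i, 0 <= u i <= U) -> (forall j, `|y j| <= L) ->
  bilinear_bound k B ->
  bilinear_bound (fun i j => k i j * expi (u i * y j)) ((1 + U * L) * B).
Proof.
move=> U0 L0 B0 uU yL kB a b a1 b1.
pose s := sort <=%R [seq u i | i <- enum I].
have sE z : z \in s -> exists i, z = u i.
  by rewrite mem_sort; case/mapP => i _ ->; exists i.
have ps : path <=%R 0 s.
  rewrite path_min_sorted; first by apply: sort_sorted; exact: le_total.
  by apply/allP => z /sE[i ->]; case/andP: (uU i).
have us i : u i \in 0 :: s.
  by rewrite inE mem_sort map_f ?orbT// mem_enum.
have lU : last 0 s <= U.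
  by have := mem_last 0 s; rewrite inE => /orP[/eqP -> //|/sE[i ->]]; case/andP: (uU i).
apply: le_trans (_ : (1 + (last 0 s - 0) * L) * B <= _).
  have := bilinear_bound_expi_path L0 yL kB ps us a1 b1.
  by under eq_bigr do under eq_bigr do rewrite subr0.
by rewrite subr0 ler_wpM2r// lerD2l ler_wpM2r.
Qed.

Lemma normc_sum_sqr J (z : J -> R[i]) :
  ((normc (\sum_j z j)) ^+ 2)%:C = \sum_j \sum_j' z j * (z j')^*%C.
Proof.
by rewrite normc_sqrE rmorph_sum /= big_distrlr.
Qed.

(** A geometric sum over powers of w with w^M = 1, which vanishes unless w = 1. *)
Lemma sum_expi_orthogonal M (d d' : 'I_M) :
  \sum_(c < M) expi (2 * pi / M%:R *+ (c * d)) * (expi (2 * pi / M%:R *+ (c * d')))^*%C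
  = (d == d')%:R * M%:R :> R[i].
Proof.
have M0 : (0 < M)%N by case: (M) d => [[]|].
have MR : M%:R != 0 :> R by rewrite pnatr_eq0 -lt0n.
pose w : R[i] := expi (2 * pi / M%:R * (d%:R - d'%:R)).
have -> : \sum_(c < M) expi (2 * pi / M%:R *+ (c * d)) *
    (expi (2 * pi / M%:R *+ (c * d')))^*%C = \sum_(c < M) w ^+ c.
  apply: eq_bigr => c _. rewrite expi_conj -expiD -expiMn; congr expi.
  rewrite -(mulr_natr _ (c * d)) -(mulr_natr _ (c * d')) -(mulr_natr _ c) !natrM; ring.
have [dE|dd'] := eqVneq d d'.
  rewrite mul1r /w dE subrr mulr0 expi0.
  by under eq_bigr do rewrite expr1n; rewrite sumr_const card_ord.
rewrite mul0r; apply/eqP.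
have wM : w ^+ M = 1.
  rewrite -expiMn (_ : _ *+ M = 2 * pi *+ d - 2 * pi *+ d').
    by rewrite expiD -expi_conj !expi_2pi_eq1 conjc1 mulr1.
  by rewrite -(mulr_natr _ M) -(mulr_natr _ d) -(mulr_natr _ d'); field.
have := subrX1 w M; rewrite wM subrr => /esym/eqP.
rewrite mulf_eq0 => /orP[|//].
rewrite subr_eq0 => /eqP w1.
(* If w = 1, then cos(2 theta) = 1 for theta = pi |d - d'| / M, so sin(theta) = 0; but 0 < theta <
   pi. *)
suff : sin (pi / M%:R * `|d%:R - d'%:R|) = 0 :> R.
  move=> s0; suff : 0 < sin (pi / M%:R * `|d%:R - d'%:R|) :> R by rewrite s0 ltxx.
  have dM (e : 'I_M) : e%:R < M%:R :> R by rewrite ltr_nat.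
  have MP : 0 < M%:R :> R by rewrite ltr0n.
  apply: sin_gt0_pi; apply/andP; split.
    by rewrite mulr_gt0 ?divr_gt0 ?pi_gt0// normr_gt0 subr_eq0 eqr_nat.
  rewrite -mulrA gtr_pMr ?pi_gt0// mulrC ltr_pdivrMr// mul1r ltr_norml.
  have := dM d; have := dM d'; have := ler0n R d; have := ler0n R d'; lra.
have : cos (2 * pi / M%:R * (d%:R - d'%:R)) = 1 :> R by case: w1.
rewrite -cos_norm normrM ger0_norm ?divr_ge0 ?mulr_ge0 ?pi_ge0//.
rewrite (_ : 2 * pi / M%:R * `|d%:R - d'%:R| = (pi / M%:R * `|d%:R - d'%:R|) *+ 2); last by field.
rewrite cos_mulr2n cos2sin2 => s1; apply/eqP; rewrite -sqrf_eq0; apply/eqP; lra.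
Qed.

Lemma discrete_parseval M (b : 'I_M -> R[i]) :
  \sum_(c < M) normc (\sum_(d < M) b d * expi (2 * pi / M%:R *+ (c * d))) ^+ 2
  = M%:R * \sum_d normc (b d) ^+ 2.
Proof.
(* Over the complex numbers |z|^2 becomes z times its conjugate and can be expanded. *)
apply: (@complexI R).
rewrite rmorph_sum /=.
under eq_bigr do rewrite normc_sum_sqr.
rewrite exchange_big /=; under eq_bigr do rewrite exchange_big /=.
transitivity (\sum_(d < M) \sum_(d' < M) b d * (b d')^*%C * ((d == d')%:R * M%:R)).
  apply: eq_bigr => d _; apply: eq_bigr => d' _.
  rewrite -sum_expi_orthogonal mulr_sumr; apply: eq_bigr => c _.
  by rewrite rmorphM /=; ring.
rewrite rmorphM rmorph_sum mulr_sumr; apply: eq_bigr => d _ /=.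
rewrite (bigD1 d)//= eqxx big1 ?addr0 => [|d' dd']; last first.
  by rewrite eq_sym (negbTE dd') mul0r mulr0.
by rewrite mul1r normc_sqrE mulrC rmorph_nat.
Qed.

(** Group the coefficients by the values c of f and d of g: each group is bounded by its
    cardinality. Cauchy-Schwarz in c followed by Parseval in d leaves the sums of squared
    cardinalities. *)
Lemma bilinear_bound_dft I J M (f : I -> 'I_M) (g : J -> 'I_M) :
  bilinear_bound (fun i j => expi (2 * pi / M%:R *+ (f i * g j)))
    (Num.sqrt (M%:R * (\sum_c #|[pred i | f i == c]| ^ 2)%:R *
      (\sum_d #|[pred j | g j == d]| ^ 2)%:R)).
Proof.
move=> a b a1 b1.
pose al c := \sum_(i | f i == c) a i; pose be d := \sum_(j | g j == d) b j.
have bnd (T : finType) (h : T -> 'I_M) (z : T -> R[i]) c :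
    (forall i, normc (z i) <= 1) ->
    normc (\sum_(i | h i == c) z i) <= #|[pred i | h i == c]|%:R.
  move=> z1; apply: le_trans (ler_normc_sum _ _ _) _.
  rewrite -sum1_card natr_sum; exact: ler_sum.
have -> : \sum_i \sum_j a i * b j * expi (2 * pi / M%:R *+ (f i * g j)) =
    \sum_c al c * \sum_d be d * expi (2 * pi / M%:R *+ (c * d)).
  rewrite (partition_big f predT)//=; apply: eq_bigr => c _.
  rewrite mulr_suml; apply: eq_bigr => i /eqP fi.
  rewrite (partition_big g predT)//= mulr_sumr; apply: eq_bigr => d _.
  rewrite mulr_suml mulr_sumr; apply: eq_bigr => j /eqP gj.
  by rewrite fi gj mulrA.
rewrite -[leLHS]ger0_norm ?normc_ge0// -sqrtr_sqr ler_wsqrtr//.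
apply: le_trans (_ : (\sum_c normc (al c) *
    normc (\sum_d be d * expi (2 * pi / M%:R *+ (c * d)))) ^+ 2 <= _).
  rewrite lerXn2r ?nnegrE ?normc_ge0 ?sumr_ge0// => [c _|].
    by rewrite mulr_ge0// normc_ge0.
  apply: le_trans (ler_normc_sum _ _ _) _.
  by under eq_bigr do rewrite Normc.normcM.
apply: le_trans (cauchy_schwarz_sum _ _) _.
rewrite discrete_parseval mulrCA -mulrA ler_wpM2l//.
rewrite ler_pM ?sumr_ge0// => [i _|i _||]; rewrite ?exprn_ge0 ?normc_ge0//.
  by rewrite natr_sum ler_sum// => c _; rewrite natrX lerXn2r ?nnegrE ?normc_ge0 ?bnd.
by rewrite natr_sum ler_sum// => c _; rewrite natrX lerXn2r ?nnegrE ?normc_ge0 ?bnd.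
Qed.

End BilinearForms.

(** * Holder's inequality in both variables *)

Section DoubleHolder.
Variable R : realType.

Lemma expr_sum_ffun (S : comNzRingType) (I : finType) k (F : I -> S) :
  (\sum_i F i) ^+ k = \sum_(x : {ffun 'I_k -> I}) \prod_l F (x l).
Proof.
transitivity (\prod_(l < k) \sum_i F i); first by rewrite prodr_const card_ord.
exact: bigA_distr_bigA.
Qed.

(** Raise the sum over i to the power k1 + 1 for each j and expand it over tuples x; after
    exchanging the sums, raise the sum over j to the power k2 + 1 for each x and expand it over
    tuples y. The phases that remove the moduli become [a] and [b]. *)
Lemma double_holder (I J : finType) k1 k2 (F : I -> J -> R[i]) :
  exists (a : {ffun 'I_k1.+1 -> I} -> R[i]) (b : {ffun 'I_k2.+1 -> J} -> R[i]),
  [/\ forall x, normc (a x) <= 1, forall y, normc (b y) <= 1 &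
    normc (\sum_i \sum_j F i j) ^+ (k1.+1 * k2.+1) <=
      #|J|%:R ^+ (k1 * k2.+1) * #|I|%:R ^+ (k1.+1 * k2) *
      normc (\sum_x \sum_y a x * b y * \prod_l' \prod_l F (x l) (y l'))].
Proof.
have /fin_all_exists2[c c1 cE] := fun j =>
  normc_phase ((\sum_i F i j) ^+ k1.+1).
pose G (x : {ffun 'I_k1.+1 -> I}) j := \prod_l F (x l) j.
pose g x := \sum_j c j * G x j.
have /fin_all_exists2[a a1 aE] := fun x => normc_phase (g x ^+ k2.+1).
exists a, (fun y => \prod_l c (y l)); split => // [y|].
  by rewrite normc_prod; apply: prodr_ile1 => l _; rewrite normc_ge0 c1.
have S1 : normc (\sum_i \sum_j F i j) ^+ k1.+1 <=
    #|J|%:R ^+ k1 * \sum_x normc (g x).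
  apply: le_trans (_ : (\sum_j normc (\sum_i F i j)) ^+ k1.+1 <= _).
    rewrite lerXn2r ?nnegrE ?normc_ge0 ?sumr_ge0// => [j _|]; first exact: normc_ge0.
    by rewrite exchange_big ler_normc_sum.
  apply: le_trans (power_mean_sum _ (fun j => normc_ge0 _)) _.
  rewrite ler_wpM2l ?exprn_ge0//.
  have -> : \sum_j normc (\sum_i F i j) ^+ k1.+1 = normc (\sum_x g x).
    apply: (@complexI R); rewrite -[RHS]/`|\sum_x g x|.
    have <- : (\sum_j normc (\sum_i F i j) ^+ k1.+1)%:C = \sum_x g x.
      rewrite rmorph_sum [RHS]exchange_big; apply: eq_bigr => j _ /=.
      by rewrite -normcX cE expr_sum_ffun mulr_sumr.
    rewrite -[RHS]/((normc _)%:C) normc_real ger0_norm// sumr_ge0// => j _.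
    by rewrite exprn_ge0 ?normc_ge0.
  exact: ler_normc_sum.
rewrite exprM; apply: le_trans (_ : (#|J|%:R ^+ k1 * \sum_x normc (g x)) ^+ k2.+1 <= _).
  rewrite lerXn2r ?nnegrE ?exprn_ge0 ?normc_ge0// mulr_ge0 ?exprn_ge0// sumr_ge0// => x _.
  exact: normc_ge0.
rewrite exprMn -exprM -mulrA ler_wpM2l ?exprn_ge0//.
apply: le_trans (power_mean_sum _ (fun x => normc_ge0 _)) _.
rewrite card_ffun card_ord natrX -exprM ler_wpM2l ?exprn_ge0//.
rewrite -[leLHS]ger0_norm; last by apply: sumr_ge0 => x _; rewrite exprn_ge0 ?normc_ge0.
rewrite -normc_real rmorph_sum.
rewrite le_eqVlt; apply/orP; left; apply/eqP; congr normc; apply: eq_bigr => x _ /=.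
rewrite -normcX aE expr_sum_ffun mulr_sumr; apply: eq_bigr => y _.
by rewrite big_split /= mulrA.
Qed.

End DoubleHolder.

(** * Pairs of points in a common cell *)

Lemma sum_fiber_sqr (I T : finType) (f : I -> T) :
  (\sum_c #|[pred i | f i == c]| ^ 2 = #|[pred z : I * I | f z.1 == f z.2]|)%N.
Proof.
rewrite -sum1_card -(pair_big_dep predT (fun i j => f i == f j) (fun _ _ => 1%N))/=.
rewrite (partition_big f predT)//=; apply: eq_bigr => c _.
rewrite -mulnn -{1}sum1_card big_distrl /=; apply: eq_bigr => i /eqP <-.
by rewrite mul1n -sum1_card; apply: eq_bigl => j; rewrite inE eq_sym.
Qed.

(** Cauchy-Schwarz over the r subcells of each cell. *)
Lemma sum_fiber_sqr_refine (I T : finType) (f : I -> T) r (q : I -> 'I_r) :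
  (\sum_c #|[pred i | f i == c]| ^ 2 <=
    r * #|[pred z : I * I | (f z.1 == f z.2) && (q z.1 == q z.2)]|)%N.
Proof.
have -> : #|[pred z : I * I | (f z.1 == f z.2) && (q z.1 == q z.2)]| =
    (\sum_c \sum_d #|[pred i | (f i == c) && (q i == d)]| ^ 2)%N.
  transitivity #|[pred z : I * I | (f z.1, q z.1) == (f z.2, q z.2)]|.
    exact: eq_card.
  rewrite -(sum_fiber_sqr (fun i => (f i, q i))) pair_big /=.
  by apply: eq_bigr => -[].
rewrite big_distrr /=; apply: leq_sum => c _.
have -> : #|[pred i | f i == c]| = (\sum_d #|[pred i | (f i == c) && (q i == d)]|)%N.
  rewrite -sum1_card (partition_big q predT)//=; apply: eq_bigr => d _.
  by rewrite -sum1_card.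
rewrite -(ler_nat int) natrX natrM !natr_sum.
have := @power_mean_sum int 'I_r 1
  (fun d => #|[pred i | (f i == c) && (q i == d)]|%:R) (fun d => ler0n _ _).
by rewrite card_ord expr1; under [in leRHS]eq_bigr do rewrite -natrX.
Qed.

(** * Spacing of the sums of reciprocals *)

Section ReciprocalSums.
Variables (R : realType) (k N : nat).
Implicit Types x y : {ffun 'I_k -> 'I_N}.

Definition reciprocal_sum x : R := \sum_l (dyadic x l)%:R^-1.

Lemma reciprocal_sum_ge0 x : 0 <= reciprocal_sum x.
Proof. by apply: sumr_ge0 => l _; rewrite invr_ge0. Qed.

Lemma reciprocal_sum_lt x : (0 < k)%N -> (0 < N)%N ->
  reciprocal_sum x < k%:R / N%:R.
Proof.
move=> k0 N0; rewrite -[k in ltRHS]card_ord mulr_natl -sumr_const.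
apply: ltr_sum => [|l _]; last first.
  by rewrite ltf_pV2 ?posrE ?ltr0n// ltr_nat /dyadic ltnS leq_addr.
by apply/hasP; exists (Ordinal k0); rewrite ?mem_index_enum.
Qed.

Lemma reciprocal_sum_num x :
  reciprocal_sum x * (dyadic_prod x)%:R = (dyadic_num x)%:R.
Proof.
rewrite mulr_suml natr_sum; apply: eq_bigr => l _.
by rewrite /dyadic_prod (bigD1 l)//= natrM mulKf// pnatr_eq0.
Qed.

(* Distinct fractions with denominators W, W' differ by at least 1 / (W W'). *)
Lemma reciprocal_sum_separated x y :
  `|reciprocal_sum x - reciprocal_sum y| * ((2 * N) ^ (2 * k))%:R < 1 ->
  (x, y) \in equal_reciprocal_sums k N.
Proof.
set d : R := `|_|; move=> dN; rewrite inE /=.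
rewrite -(eqr_nat R) !natrM -!reciprocal_sum_num.
have : d * (dyadic_prod x * dyadic_prod y)%:R < 1.
  apply: le_lt_trans dN; rewrite ler_wpM2l ?normr_ge0// ler_nat (mul2n k) -addnn expnD.
  by rewrite leq_mul// dyadic_prod_le.
rewrite -[X in _ * X]ger0_norm// -normrM natrM mulrBl.
have -> : reciprocal_sum x * ((dyadic_prod x)%:R * (dyadic_prod y)%:R) =
   (dyadic_num x * dyadic_prod y)%:R by rewrite natrM -reciprocal_sum_num mulrA.
have -> : reciprocal_sum y * ((dyadic_prod x)%:R * (dyadic_prod y)%:R) =
   (dyadic_num y * dyadic_prod x)%:R.
  by rewrite natrM -reciprocal_sum_num; ring.
rewrite !reciprocal_sum_num -!natrM eqr_nat.
set A := (_ * _)%N; set B := (_ * _)%N => AB; apply/eqP.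
have [lAB|lBA|//] := ltngtP A B.
- move: AB; rewrite distrC -natrB 1?ltnW// ger0_norm// ltrn1; lia.
- move: AB; rewrite -natrB 1?ltnW// ger0_norm// ltrn1; lia.
Qed.

(** With D = (2N)^(2k), cut each cell of length d into at most d D + 1 subcells of length 1 / D. Two
    tuples in the same subcell have sums closer than 1 / D, hence equal. *)
Lemma cell_count M (f : {ffun 'I_k -> 'I_N} -> 'I_M) (u : {ffun 'I_k -> 'I_N} -> R) d :
  0 <= d ->
  (forall x, 0 <= u x < d) -> (forall x, reciprocal_sum x = (f x)%:R * d + u x) ->
  (\sum_c #|[pred x | f x == c]| ^ 2)%:R <=
    (d * ((2 * N) ^ (2 * k))%:R + 1) * #|equal_reciprocal_sums k N|%:R.
Proof.
move=> d0 ud sE; set D : R := ((2 * N) ^ (2 * k))%:R.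
have D0 : 0 <= D by exact: ler0n.
have dD0 : 0 <= d * D by rewrite mulr_ge0.
have uD0 x : 0 <= u x * D by rewrite mulr_ge0//; case/andP: (ud x).
pose q x : 'I_(Num.truncn (d * D)).+1 := inord (Num.truncn (u x * D)).
have qE x : q x = Num.truncn (u x * D) :> nat.
  rewrite inordK// ltnS truncn_ge_nat//; apply: le_trans (_ : u x * D <= _).
    by rewrite truncn_le.
  by rewrite ler_wpM2r//; case/andP: (ud x) => _ /ltW.
apply: le_trans (_ : ((Num.truncn (d * D)).+1 * #|equal_reciprocal_sums k N|)%:R <= _).
  rewrite ler_nat; apply: leq_trans (sum_fiber_sqr_refine f q) _.
  rewrite leq_mul2l; apply/orP; right; apply: subset_leq_card; apply/subsetP.
  move=> [x y]; rewrite inE /= => /andP[/eqP fxy /eqP qxy].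
  apply: reciprocal_sum_separated; rewrite -/D !sE fxy.
  rewrite (_ : _ + u x - _ = u x - u y); last by ring.
  rewrite -[D in X in X < _]ger0_norm// -normrM mulrBl.
  have := congr1 (@nat_of_ord _) qxy; rewrite !qE => qxy'.
  have := truncn_itv (uD0 x); have := truncn_itv (uD0 y); rewrite qxy' -natr1.
  by rewrite ltr_norml; lra.
by rewrite natrM ler_wpM2r// -natr1 lerD2r truncn_le.
Qed.

End ReciprocalSums.

(** * The exponential sum *)

Section ExponentialSum.
Variable R : realType.

Lemma equal_reciprocal_sums_powR k (eps : R) : 0 < eps ->
  exists2 C : R, 1 <= C & forall N, (0 < N)%N ->
    #|equal_reciprocal_sums k N|%:R <= C * (N%:R ^+ k * N%:R `^ eps).
Proof.
move=> e0; set r := (2 * k * (2 * k).+1)%N.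
(* K exceeds r / eps, so the K-th root of N^r is at most N^eps. *)
pose K := (Num.truncn (r%:R / eps)).+1.
have rK : r%:R <= eps * K%:R.
  by rewrite mulrC -ler_pdivrMr// ltW// truncnS_gt.
have [C C0 hC] := card_equal_reciprocal_sums k (ltn0Sn (Num.truncn (r%:R / eps))).
exists C%:R; first by rewrite ler1n.
move=> N N0; have N1 : 1 <= N%:R :> R by rewrite ler1n.
rewrite -(@ler_pXn2r _ K)// ?nnegrE ?mulr_ge0 ?exprn_ge0 ?powR_ge0//.
apply: le_trans (_ : (C * N ^ (k * K + r))%:R <= _).
  by rewrite -natrX ler_nat; exact: hC.
rewrite natrM natrX exprD !exprMn -exprM.
apply: ler_pM; rewrite ?mulr_ge0 ?exprn_ge0//.
  by rewrite ler_eXnr// ler1n.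
rewrite ler_wpM2l ?exprn_ge0//.
by rewrite -!powR_mulrn ?powR_ge0// -powRrM ler_powR.
Qed.

Lemma grid_bilinear_bound k1 k2 N1 N2 (xi : R) :
  (0 < k1)%N -> (0 < k2)%N -> (0 < N1)%N -> (0 < N2)%N ->
  let T := xi / (N1%:R * N2%:R) in
  let P k N := (8 / (T * N%:R) * ((2 * N) ^ (2 * k))%:R + 1) *
                 #|equal_reciprocal_sums k N|%:R in
  1 < T ->
  bilinear_bound (fun (x : {ffun 'I_k1 -> 'I_N1}) (y : {ffun 'I_k2 -> 'I_N2}) =>
      expi (xi * (reciprocal_sum R x * reciprocal_sum R y)))
    (81 * Num.sqrt ((k1 * k2).+1%:R * T * P k1 N1 * P k2 N2)).
Proof.
move=> k10 k20 N10 N20 T P T1.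
have pi1 : 1 <= pi :> R by have := pi_ge2 R; lra.
have pi4 : pi < 4 :> R by have := pihalf_lt2 R; lra.
have [n1 n2] : 0 < N1%:R :> R /\ 0 < N2%:R :> R by rewrite !ltr0n.
have [q1 q2] : 1 <= k1%:R :> R /\ 1 <= k2%:R :> R by rewrite !ler1n.
have [p1 p2] : 0 < k1%:R :> R /\ 0 < k2%:R :> R by rewrite !ltr0n.
have [T0 pi0] : 0 < T /\ 0 < pi :> R by split; lra.
have xiE : xi = T * (N1%:R * N2%:R) by rewrite /T divfK// mulf_neq0// lt0r_neq0.
clearbody T; pose M' := Num.truncn (k1%:R * k2%:R * T); pose M := M'.+1.
have kT0 : 0 <= k1%:R * k2%:R * T by rewrite !mulr_ge0// ltW.
have M0 : 0 < M%:R :> R by rewrite ltr0n.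
have Mgt : k1%:R * k2%:R * T < M%:R by exact: truncnS_gt.
(* The 1 lost in rounding is at most T, because T > 1. *)
have Mle : M%:R <= (k1 * k2).+1%:R * T.
  by rewrite /M -natr1 -natr1 mulrDl mul1r natrM lerD ?truncn_le// ltW.
(* The lengths satisfy xi d1 d2 = 2 pi / M, and M cells cover both ranges [0, k1 / N1) and [0, k2 /
   N2). *)
pose d1 : R := 2 * pi / (k2%:R * (T * N1%:R)).
pose d2 : R := k2%:R / (N2%:R * M%:R).
have d1_gt0 : 0 < d1 by rewrite divr_gt0// !mulr_gt0.
have d2_gt0 : 0 < d2 by rewrite divr_gt0// mulr_gt0.
have grid (T' : Type) (s : T' -> R) (d : R) : 0 < d ->
    (forall x, 0 <= s x) -> (forall x, s x < d * M%:R) ->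
    exists (f : T' -> 'I_M) (u : T' -> R),
      (forall x, 0 <= u x < d) /\ (forall x, s x = (f x)%:R * d + u x).
  move=> d0 s0 sM; pose f x : 'I_M := inord (Num.truncn (s x / d)).
  have sd0 x : 0 <= s x / d by rewrite divr_ge0// ltW.
  have fE x : f x = Num.truncn (s x / d) :> nat.
    by rewrite inordK// truncn_lt_nat// ltr_pdivrMr// mulrC.
  exists f, (fun x => s x - (f x)%:R * d); split => x; last by ring.
  have := truncn_itv (sd0 x); rewrite fE -natr1 ler_pdivlMr// ltr_pdivrMr//; lra.
have [|x|f [u [uE sE]]] := grid _ (@reciprocal_sum R k1 N1) d1 d1_gt0.
- exact: reciprocal_sum_ge0.
- apply: lt_le_trans (reciprocal_sum_lt R x k10 N10) _.
  rewrite /d1 mulrAC ler_pdivlMr ?mulr_gt0//.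
  rewrite [leLHS](_ : _ = k1%:R * k2%:R * T); last by field; rewrite lt0r_neq0.
  nra.
have [|y|g [v [vE tE]]] := grid _ (@reciprocal_sum R k2 N2) d2 d2_gt0.
- exact: reciprocal_sum_ge0.
- apply: lt_le_trans (reciprocal_sum_lt R y k20 N20) _.
  by rewrite /d2 invfM mulrA divfK// lt0r_neq0.
pose B0 : R := Num.sqrt (M%:R * (\sum_c #|[pred x | f x == c]| ^ 2)%:R *
      (\sum_d #|[pred y | g y == d]| ^ 2)%:R).
have H0 : bilinear_bound (fun x y => expi (2 * pi / M%:R *+ (f x * g y))) B0.
  exact: bilinear_bound_dft.
have B00 : 0 <= B0 by exact: sqrtr_ge0.
have xi0 : 0 <= xi by rewrite xiE !mulr_ge0// ltW.
have xd0 : 0 <= xi * d1 by rewrite mulr_ge0// ltW.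
have t2 (y : {ffun 'I_k2 -> 'I_N2}) : `|xi * reciprocal_sum R y| <= xi * (k2%:R / N2%:R).
  rewrite ger0_norm ?mulr_ge0 ?reciprocal_sum_ge0// ler_wpM2l// ltW//.
  exact: reciprocal_sum_lt.
have t1 x : `|xi * d1 * (f x)%:R| <= xi * d1 * M%:R.
  by rewrite ger0_norm ?(mulr_ge0 xd0)// ler_wpM2l// ler_nat ltnW.
have uE' x : 0 <= u x <= d1 by case/andP: (uE x) => -> /ltW ->.
have vE' y : 0 <= v y <= d2 by case/andP: (vE y) => -> /ltW ->.
have L2 : 0 <= xi * (k2%:R / N2%:R) by rewrite mulr_ge0// divr_ge0.
have L1 : 0 <= xi * d1 * M%:R by rewrite mulr_ge0.
(* First e(xi u s(y)), then, with the variables exchanged, e(xi c d1 v) is restored; each costs a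
   factor 1 + 2 pi. *)
have := bilinear_bound_expi (ltW d1_gt0) L2 B00 uE' t2 H0.
rewrite (_ : d1 * _ = 2 * pi); last by rewrite xiE /d1; field; rewrite !lt0r_neq0.
move/bilinear_bound_sym/(bilinear_bound_expi (ltW d2_gt0) L1 _ vE' t1).
rewrite (_ : d2 * _ = 2 * pi); last by rewrite xiE /d1 /d2; field; rewrite !lt0r_neq0.
rewrite mulr_ge0// => [/(_ isT)/bilinear_bound_sym H|]; last by lra.
have {}H : bilinear_bound (fun (x : {ffun 'I_k1 -> 'I_N1}) (y : {ffun 'I_k2 -> 'I_N2}) =>
    expi (xi * (reciprocal_sum R x * reciprocal_sum R y))) ((1 + 2 * pi) * ((1 + 2 * pi) * B0)).
  apply: bilinear_bound_eq H => x y; rewrite -!expiD; congr expi.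
  rewrite sE tE -(mulr_natr _ (f x * g y)) natrM.
  have -> : 2 * pi / M%:R = xi * d1 * d2.
    by rewrite xiE /d1 /d2; field; rewrite !lt0r_neq0.
  ring.
move=> a b a1 b1; apply: le_trans (H a b a1 b1) _.
(* (1 + 2 pi)^2 <= 81 since pi < 4. *)
rewrite mulrA ler_pM ?mulr_ge0//; [lra|lra|nra|].
rewrite ler_wsqrtr//.
have cell (k N : nat) d (f' : {ffun 'I_k -> 'I_N} -> 'I_M) u' : (0 < N)%N ->
    0 < d -> d <= 8 / (T * N%:R) -> (forall x, 0 <= u' x < d) ->
    (forall x, reciprocal_sum R x = (f' x)%:R * d + u' x) ->
    (\sum_c #|[pred x | f' x == c]| ^ 2)%:R <= P k N.
  move=> N0 d0 dle u'd s'E; apply: le_trans (cell_count (ltW d0) u'd s'E) _.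
  by rewrite /P ler_wpM2r// lerD2r ler_wpM2r.
have d1_le : d1 <= 8 / (T * N1%:R).
  rewrite ler_pdivlMr ?mulr_gt0// (_ : d1 * _ = 2 * pi / k2%:R).
    by rewrite ler_pdivrMr//; nra.
  by rewrite /d1; field; rewrite !lt0r_neq0.
have d2_le : d2 <= 8 / (T * N2%:R).
  rewrite ler_pdivlMr ?mulr_gt0// (_ : d2 * _ = k2%:R * T / M%:R).
    rewrite ler_pdivrMr//.
    have : k2%:R * T <= M%:R.
      apply: le_trans (ltW Mgt); rewrite -mulrA ler_peMl ?mulr_ge0// ltW//.
    by nra.
  by rewrite /d2; field; rewrite !lt0r_neq0.
have Q1 := cell _ _ _ _ _ N10 d1_gt0 d1_le uE sE.
have Q2 := cell _ _ _ _ _ N20 d2_gt0 d2_le vE tE.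
by apply: ler_pM => //; [rewrite mulr_ge0|apply: ler_pM].
Qed.

(** Inserting the bound for the coincidences, the normalised cell count is at most a constant times
    E (N^(k-1) / T + N^(-k)). Squaring with (a + b)^2 <= 2 (a^2 + b^2) and multiplying by T produces
    the two terms of [gamma_factor]. *)
Lemma gamma_factor_lower k (N : nat) (C E T : R) :
  (0 < k)%N -> (0 < N)%N -> 0 < T -> 1 <= C -> 0 <= E ->
  #|equal_reciprocal_sums k N|%:R <= C * (N%:R ^+ k * E) ->
  T * ((8 / (T * N%:R) * ((2 * N) ^ (2 * k))%:R + 1) *
         #|equal_reciprocal_sums k N|%:R / N%:R ^+ (2 * k)) ^+ 2 <=
  2 * (8 * 4 ^+ k * C) ^+ 2 * E ^+ 2 * (T * N%:R ^- (2 * k) + T^-1 * N%:R ^+ (2 * k.-1)).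
Proof.
case: k => // k _ N0 T0 C1 E0; set J : R := #|equal_reciprocal_sums _ _|%:R => hJ.
have n0 : 0 < N%:R :> R by rewrite ltr0n.
have J0 : 0 <= J by exact: ler0n.
move: J hJ J0 => J; set n : R := N%:R in n0 *.
have -> : ((2 * N) ^ (2 * k.+1))%:R = 4 ^+ k.+1 * (n * n ^+ k) ^+ 2 :> R.
  rewrite natrX natrM exprMn -/n [2 ^+ _]exprM (_ : 2 ^+ 2 = 4 :> R); last by ring.
  by rewrite -exprS -exprM (mulnC 2).
have -> : n ^+ (2 * k.+1) = (n * n ^+ k) ^+ 2 by rewrite -exprS -exprM (mulnC 2).
have -> : n ^+ (2 * k.+1.-1) = (n ^+ k) ^+ 2 by rewrite /= -exprM mulnC.
rewrite exprS.
have p0 : 0 < n ^+ k by rewrite exprn_gt0.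
(* After the case split on k, p stands for N^(k-1) in terms of the original k. *)
move: (n ^+ k) p0 => p p0 hJ J0.
have q1 : 1 <= 4 ^+ k.+1 :> R by rewrite exprn_ege1// ler1n.
move: (4 ^+ k.+1) q1 => q q1.
have np0 : 0 < n * p by rewrite mulr_gt0.
set D := 8 * q * C.
have D0 : 0 <= D by rewrite !mulr_ge0//; lra.
have le1 : (8 / (T * n) * (q * (n * p) ^+ 2) + 1) * J / (n * p) ^+ 2 <=
    D * E * (p / T + (n * p)^-1).
  apply: le_trans (_ : (8 / (T * n) * (q * (n * p) ^+ 2) + 1) *
      (C * (n * p * E)) / (n * p) ^+ 2 <= _).
    rewrite ler_wpM2r ?invr_ge0 ?exprn_ge0 ?(ltW np0)// ler_wpM2l//.
    rewrite addr_ge0// !mulr_ge0 ?invr_ge0 ?mulr_ge0 ?exprn_ge0 ?(ltW n0) ?(ltW p0)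
      ?(ltW T0)//; lra.
  rewrite [leLHS](_ : _ = C * E * (8 * q * (p / T) + (n * p)^-1)); last first.
    by field; rewrite !lt0r_neq0.
  have CE : 0 <= C * E by rewrite mulr_ge0//; lra.
  have a0 : 0 <= p / T by rewrite divr_ge0 ?ltW.
  have b0 : 0 <= (n * p)^-1 by rewrite invr_ge0 ltW.
  rewrite [leRHS](_ : _ = C * E * (8 * q * (p / T) + 8 * q * (n * p)^-1)); last first.
    by rewrite /D; ring.
  by rewrite ler_wpM2l// lerD2l ler_peMl//; lra.
have ge1 : 0 <= (8 / (T * n) * (q * (n * p) ^+ 2) + 1) * J / (n * p) ^+ 2.
  rewrite divr_ge0 ?exprn_ge0 ?(ltW np0)// mulr_ge0// addr_ge0//.
  by rewrite mulr_ge0 ?divr_ge0 ?mulr_ge0 ?exprn_ge0 ?(ltW n0) ?(ltW np0) ?(ltW T0)//; lra.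
apply: le_trans (_ : T * (D * E * (p / T + (n * p)^-1)) ^+ 2 <= _).
  rewrite ler_wpM2l ?(ltW T0)// lerXn2r ?nnegrE//.
  exact: le_trans le1.
rewrite exprMn exprMn.
have -> : T * (n * p) ^- 2 + T^-1 * p ^+ 2 = T * ((p / T) ^+ 2 + (n * p)^-1 ^+ 2).
  by field; rewrite !lt0r_neq0.
set a := p / T; set b := (n * p)^-1.
have DE : 0 <= D ^+ 2 * E ^+ 2 * T.
  by apply: mulr_ge0; [apply: mulr_ge0; exact: sqr_ge0|exact: ltW].
rewrite [leLHS](_ : _ = D ^+ 2 * E ^+ 2 * T * (a + b) ^+ 2); last by ring.
rewrite [leRHS](_ : _ = D ^+ 2 * E ^+ 2 * T * (2 * (a ^+ 2 + b ^+ 2))); last by ring.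
by rewrite ler_wpM2l//; have := sqr_ge0 (a - b); nra.
Qed.

Lemma sum_dyadicE (V : nmodType) N (F : nat -> V) :
  \sum_(N.+1 <= n < (2 * N).+1) F n = \sum_(i < N) F (N + i).+1.
Proof.
rewrite -[N.+1]add0n big_addn big_mkord (_ : (_ - _)%N = N); last by lia.
by apply: eq_bigr => i _; congr F; lia.
Qed.

(** Changing the sign of xi conjugates the sum, so xi may be taken nonnegative. *)
Lemma normc_double_sum_abs N1 N2 (xi : R) :
  normc (\sum_(N1.+1 <= n1 < (2 * N1).+1) \sum_(N2.+1 <= n2 < (2 * N2).+1)
     expi (n1%:R^-1 * n2%:R^-1 * xi)) =
  normc (\sum_(i < N1) \sum_(j < N2)
     expi (`|xi| * ((N1 + i).+1%:R^-1 * (N2 + j).+1%:R^-1))).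
Proof.
rewrite sum_dyadicE; under eq_bigr do rewrite sum_dyadicE.
have [xi0|xi0] := leP 0 xi.
  by congr normc; apply: eq_bigr => i _; apply: eq_bigr => j _; rewrite (ger0_norm xi0) mulrC.
rewrite -[RHS]normc_conj; congr normc.
rewrite rmorph_sum; apply: eq_bigr => i _; rewrite /= rmorph_sum.
apply: eq_bigr => j _ /=; rewrite -[RHS]/((expi _)^*%C) expi_conj (ltr0_norm xi0); congr expi; ring.
Qed.

(** Holder's inequality gives the power k1 k2; one squaring removes the square root of the bilinear
    bound, and a second one yields T^2, which is shared between the two factors T Q^2. *)
Lemma double_sum_power_bound k1 k2 N1 N2 (xi : R) :
  (0 < k1)%N -> (0 < k2)%N -> (0 < N1)%N -> (0 < N2)%N ->
  let X : R := N1%:R * N2%:R in let T := xi / X in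
  let Q k N := (8 / (T * N%:R) * ((2 * N) ^ (2 * k))%:R + 1) *
                 #|equal_reciprocal_sums k N|%:R / N%:R ^+ (2 * k) in
  1 < T ->
  normc (\sum_(i < N1) \sum_(j < N2)
     expi (xi * ((N1 + i).+1%:R^-1 * (N2 + j).+1%:R^-1))) ^+ (4 * k1 * k2) <=
  81 ^+ 4 * (k1 * k2).+1%:R ^+ 2 * X ^+ (4 * k1 * k2) *
    (T * Q k1 N1 ^+ 2) * (T * Q k2 N2 ^+ 2).
Proof.
case: k1 => // k1 _; case: k2 => // k2 _ N10 N20 X T Q T1.
have [n1 n2] : 0 < N1%:R :> R /\ 0 < N2%:R :> R by rewrite !ltr0n.
set S := normc _.
have [a [b [a1 b1 hS]]] := @double_holder R 'I_N1 'I_N2 k1 k2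
  (fun i j => expi (xi * ((N1 + i).+1%:R^-1 * (N2 + j).+1%:R^-1))).
have := @grid_bilinear_bound k1.+1 k2.+1 N1 N2 xi isT isT N10 N20 T1 a b a1 b1.
have -> : \sum_i \sum_j a i * b j * expi (xi * (reciprocal_sum R i * reciprocal_sum R j)) =
   \sum_x \sum_y a x * b y * \prod_l' \prod_l
     expi (xi * ((N1 + x l).+1%:R^-1 * (N2 + y l').+1%:R^-1)).
  apply: eq_bigr => x _; apply: eq_bigr => y _; congr (_ * _).
  under [RHS]eq_bigr do rewrite -expi_sum; rewrite -expi_sum; congr expi.
  rewrite /reciprocal_sum mulr_sumr mulr_sumr; apply: eq_bigr => l _.
  by rewrite mulr_suml mulr_sumr.
rewrite -/X -/T; set B := normc _.
set P1 := (8 / (T * N1%:R) * ((2 * N1) ^ (2 * k1.+1))%:R + 1) * _%:R.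
set P2 := (8 / (T * N2%:R) * ((2 * N2) ^ (2 * k2.+1))%:R + 1) * _%:R => hB.
move: hS; rewrite -/B -/S !card_ord => hS.
have [Q1 Q2] : P1 = Q k1.+1 N1 * N1%:R ^+ (2 * k1.+1) /\
    P2 = Q k2.+1 N2 * N2%:R ^+ (2 * k2.+1).
  have e (n : R) j : 0 < n -> n ^+ j != 0 by move=> ?; rewrite expf_neq0// lt0r_neq0.
  by rewrite /Q (divfK (e _ _ n1)) (divfK (e _ _ n2)).
have [P10 P20] : 0 <= P1 /\ 0 <= P2.
  have T0 : 0 <= T by lra.
  by split; apply: mulr_ge0 => //; apply: addr_ge0 => //; apply: mulr_ge0 => //;
    apply: divr_ge0 => //; apply: mulr_ge0.
set m := (k1.+1 * k2.+1)%N in hS *.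
have -> : (4 * k1.+1 * k2.+1 = m * 2 * 2)%N by rewrite /m; clear; lia.
have S0 : 0 <= S by exact: normc_ge0.
have B0 : 0 <= B by exact: normc_ge0.
set K : R := m.+1%:R in hB *.
have T0 : 0 <= T by lra.
have KT0 : 0 <= K * T * P1 * P2.
  by do 3!apply: mulr_ge0 => //; exact: ler0n.
pose V : R := N2%:R ^+ (k1 * k2.+1) * N1%:R ^+ (k1.+1 * k2).
rewrite -/V in hS.
have V0 : 0 <= V by rewrite mulr_ge0// exprn_ge0.
(* The Holder weights and the normalisations of the two cell counts combine to a pure power of X. *)
have VE : V ^+ 2 * (N2%:R ^+ (2 * k2.+1) * N1%:R ^+ (2 * k1.+1)) = X ^+ (m * 2).
  have e1 : (k1.+1 * k2 * 2 + 2 * k1.+1 = m * 2)%N by rewrite /m; clear; lia.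
  have e2 : (k1 * k2.+1 * 2 + 2 * k2.+1 = m * 2)%N by rewrite /m; clear; lia.
  by rewrite /V /X !exprMn -!exprM [RHS]mulrC mulrACA -!exprD e1 e2.
clearbody T X V.
have S2 : S ^+ (m * 2) <= 81 ^+ 2 * K * X ^+ (m * 2) * (T * (Q k1.+1 N1 * Q k2.+1 N2)).
  have h : S ^+ m <= V * (81 * Num.sqrt (K * T * P1 * P2)).
    by apply: le_trans hS _; rewrite ler_wpM2l.
  have h0 : 0 <= S ^+ m by exact: exprn_ge0.
  rewrite exprM; apply: le_trans (lerXn2r 2 h0 (le_trans h0 h) h) _.
  rewrite !exprMn sqr_sqrtr// -VE Q1 Q2.
  by rewrite le_eqVlt; apply/orP; left; apply/eqP; ring.
rewrite exprM; apply: le_trans (lerXn2r 2 _ _ S2) _.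
- by rewrite nnegrE exprn_ge0.
- by rewrite nnegrE; apply: le_trans S2; rewrite exprn_ge0.
by rewrite (exprM X (m * 2) 2) le_eqVlt; apply/orP; left; apply/eqP; ring.
Qed.

End ExponentialSum.

Theorem theorem14 (R : realType) (k1 k2 : nat) (eps : R)
    (hk1 : (0 < k1)%N) (hk2 : (0 < k2)%N) (heps : 0 < eps) :
  exists c : R, 0 < c /\
    forall (N1 N2 : nat) (xi : R), (0 < N1)%N -> (0 < N2)%N ->
      N1%:R * N2%:R < `|xi| ->
      `| \sum_(N1.+1 <= n1 < (2 * N1).+1)
         \sum_(N2.+1 <= n2 < (2 * N2).+1)
           expi (n1%:R^-1 * n2%:R^-1 * xi) |
        < (c * gamma k1 k2 N1 N2 xi * (N1%:R * N2%:R) `^ (1 + eps))%:C.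
Proof.
have [C1 C1_ge1 hC1] := equal_reciprocal_sums_powR k1 heps.
have [C2 C2_ge1 hC2] := equal_reciprocal_sums_powR k2 heps.
pose D k (C : R) := 2 * (8 * 4 ^+ k * C) ^+ 2.
pose C0 := 81 ^+ 4 * (k1 * k2).+1%:R ^+ 2 * D k1 C1 * D k2 C2.
have D0 k C : 0 <= D k C by rewrite mulr_ge0// sqr_ge0.
have C0_ge0 : 0 <= C0 by do 3!apply: mulr_ge0 => //; exact: exprn_ge0.
(* The added 1 makes the final inequality strict and ensures c <= c^m. *)
exists (C0 + 1); split; first by rewrite ltr_wpDl.
move=> N1 N2 xi N10 N20 Xxi; rewrite -[ltLHS]/((normc _)%:C) ltcR normc_double_sum_abs.
set S := normc _; pose m := (4 * k1 * k2)%N.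
have [n1 n2] : 0 < N1%:R :> R /\ 0 < N2%:R :> R by rewrite !ltr0n.
set X : R := N1%:R * N2%:R in Xxi *.
have X0 : 0 < X by rewrite mulr_gt0.
have T1 : 1 < `|xi| / X by rewrite ltr_pdivlMr// mul1r.
have T0 : 0 < `|xi| / X by rewrite (lt_trans _ T1).
have m4 : (3 < m)%N by rewrite /m; nia.
have := double_sum_power_bound hk1 hk2 N10 N20 T1; rewrite -/S -/m -/X => hS.
have g1 := gamma_factor_lower hk1 N10 T0 C1_ge1 (powR_ge0 _ _) (hC1 _ N10).
have g2 := gamma_factor_lower hk2 N20 T0 C2_ge1 (powR_ge0 _ _) (hC2 _ N20).
have TV : (`|xi| / X)^-1 = X / `|xi| by rewrite invf_div.
rewrite TV -/(gamma_factor N1 N2 xi N1 k1) -/(D k1 C1) in g1.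
rewrite TV -/(gamma_factor N1 N2 xi N2 k2) -/(D k2 C2) in g2.
have G0 N k : (0 < N)%N -> 0 < gamma_factor N1 N2 xi N k.
  move=> N0; have nN : 0 < N%:R :> R by rewrite ltr0n.
  apply: ltr_pwDl; first by rewrite mulr_gt0// invr_gt0 exprn_gt0.
  by rewrite -TV mulr_ge0 ?exprn_ge0// invr_ge0 ltW.
set G1 := gamma_factor N1 N2 xi N1 k1 in g1.
set G2 := gamma_factor N1 N2 xi N2 k2 in g2.
have [G10 G20] : 0 < G1 /\ 0 < G2 by split; exact: G0.
set Y := X `^ eps.
have YE : N1%:R `^ eps * N2%:R `^ eps = Y by rewrite -powRM// ltW.
have X1 : 1 <= X by rewrite /X -natrM ler1n muln_gt0 N10.
have Y1 : 1 <= Y by rewrite -[leLHS](powRr0 X) ler_powR// ltW.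
have gm : gamma k1 k2 N1 N2 xi ^+ m = G1 * G2.
  rewrite -powR_mulrn ?powR_ge0// /gamma -powRrM mulVf ?powRr1 ?mulr_ge0 ?(ltW G10) ?(ltW G20)//.
  by rewrite pnatr_eq0 -lt0n (leq_trans _ m4).
(* Compare m-th powers, m = 4 k1 k2, which removes the root in [gamma]. *)
rewrite -(@ltr_pXn2r _ m) ?nnegrE ?normc_ge0 ?(leq_trans _ m4)//; last first.
  by rewrite !mulr_ge0 ?powR_ge0// addr_ge0.
have XYE : X `^ (1 + eps) = X * Y.
  by rewrite powRD ?powRr1 ?(ltW X0)// (lt0r_neq0 X0) implybT.
rewrite XYE exprMn exprMn exprMn gm.
have {}hS : S ^+ m <= C0 * (G1 * G2) * (X ^+ m * Y ^+ 2).
  apply: le_trans hS _.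
  rewrite (_ : C0 * (G1 * G2) * (X ^+ m * Y ^+ 2) = 81 ^+ 4 * (k1 * k2).+1%:R ^+ 2 * X ^+ m *
    (D k1 C1 * N1%:R `^ eps ^+ 2 * G1) * (D k2 C2 * N2%:R `^ eps ^+ 2 * G2)); last first.
    by rewrite -YE /C0; ring.
  have A0 : 0 <= 81 ^+ 4 * (k1 * k2).+1%:R ^+ 2 * X ^+ m.
    by rewrite !mulr_ge0 ?sqr_ge0// exprn_ge0// ltW.
  have Q0 z : 0 <= `|xi| / X * z ^+ 2 by rewrite mulr_ge0 ?sqr_ge0// ltW.
  by apply: ler_pM => //; [rewrite mulr_ge0|rewrite ler_wpM2l].
apply: le_lt_trans hS _.
have XY0 : 0 < X ^+ m * Y ^+ m by rewrite mulr_gt0 ?exprn_gt0// (lt_le_trans _ Y1).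
have GG : 0 < G1 * G2 by rewrite mulr_gt0.
(* Only Y^2 was lost, and Y >= 1 with m >= 2 allows Y^m. *)
apply: le_lt_trans (_ : C0 * (G1 * G2) * (X ^+ m * Y ^+ m) < _).
  apply: ler_wpM2l; first by rewrite mulr_ge0// ltW.
  apply: ler_wpM2l; first by rewrite exprn_ge0// ltW.
  by rewrite ler_weXn2l// (leq_trans _ m4).
rewrite ltr_pM2r// ltr_pM2r//.
apply: lt_le_trans (_ : C0 + 1 <= _); first by rewrite ltrDl.
by rewrite ler_eXnr ?(leq_trans _ m4)// lerDr.
Qed.
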